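(* Let $V$ be a vector space over $\mathbb{C}$ (possibly infinite dimensional), and let $A$ be a linear operator on $V$ with $T(A)=0$ for some nonzero polynomial $T\in\mathbb{C}[x]$. Let $\lambda_1,\dots,\lambda_k$ be the distinct roots of $T$, with multiplicities $m_1,\dots,m_k$. Let $F$ be an entire function, or a rational function such that none of $\lambda_1,\dots,\lambda_k$ is a pole of $F$. Then $$F(A)=\sum_{i=1}^k T_{\lambda_i}^{(m_i-1)}(A)\,L_i(A),$$ where $T_{\lambda_i}^{(m_i-1)}(x)=\sum_{p=0}^{m_i-1}\frac{F^{(p)}(\lambda_i)}{p!}(x-\lambda_i)^p$ is the degree $m_i-1$ Taylor polynomial of $F$ at $\lambda_i$, and $L_i(A)$ is the principal Lagrange resolvent of the operator $A$ corresponding to the polynomial $T$ and the root $\lambda_i$.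
   Context: Put $n=m_1+\dots+m_k$. The principal Lagrange resolvent with respect to $\lambda_i$ is the unique polynomial $\widehat{T_i}\in\mathbb{C}[x]$ of degree less than $n$ with $\widehat{T_i}(\lambda_i)=1$, $\widehat{T_i}^{(m)}(\lambda_i)=0$ for $1\le m<m_i$, and $\widehat{T_i}^{(m)}(\lambda_j)=0$ for all $j\neq i$ and $0\le m<m_j$ (here $g^{(m)}$ is the $m$-th derivative and $g^{(0)}=g$). The principal Lagrange resolvent of the operator $A$ corresponding to $T$ and $\lambda_i$ is $L_i(A)=\widehat{T_i}(A)$. For an entire function $F(x)=\sum_{r\ge0}a_rx^r$, $F(A)=\sum_{r\ge0}a_rA^r$, the series being taken in the finite-dimensional complex algebra $\mathbb{C}[A]$ generated by $A$ (finite-dimensional because $T(A)=0$ with $T\ne0$) with its usual topology. For a rational function $F=P/Q$ in lowest terms with no poles at the $\lambda_j$, $F(A)=P(A)[Q(A)]^{-1}$ (the operator $Q(A)$ is invertible). *)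

(* Defs.v *)
From HB Require Import structures.
From mathcomp Require Import all_boot all_order all_algebra.
From mathcomp Require Import all_classical all_reals all_analysis.
From mathcomp Require Import complex.

Set Implicit Arguments.
Unset Strict Implicit.
Unset Printing Implicit Defensive.

Import Order.TTheory GRing.Theory Num.Theory numFieldNormedType.Exports.

Local Open Scope classical_set_scope.
Local Open Scope ring_scope.

(* The complex numbers over R.  [R[i]] itself carries no topology; packed as a
   [numClosedFieldType] it gets the canonical one, given by the modulus. *)
Definition Cplx (R : realType) : numClosedFieldType := R[i].

Definition is_basis (K : numFieldType) (W : lmodType K) (E : set W)
    (d : nat) (e : 'I_d -> W) : Prop :=
  E = [set w | exists c : 'I_d -> K, w = \sum_(i < d) c i *: e i] /\
  (forall c : 'I_d -> K, \sum_(i < d) c i *: e i = 0 -> forall i, c i = 0).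

(* Convergence of u to l for the usual topology of the finite-dimensional
   subspace E of W: u and l lie in E, and the coordinates of u in a basis of E
   converge to those of l.  The choice of basis is immaterial, since changes of
   basis are homeomorphisms.  W itself may be infinite-dimensional. *)
Definition fd_cvg (K : numFieldType) (W : lmodType K) (E : set W)
    (u : nat -> W) (l : W) : Prop :=
  exists (d : nat) (e : 'I_d -> W) (c : nat -> 'I_d -> K) (c0 : 'I_d -> K),
    [/\ is_basis E e,
        forall n, u n = \sum_(i < d) c n i *: e i,
        l = \sum_(i < d) c0 i *: e i &
        forall i, c n i @[n --> \oo] --> c0 i].

Section Operators.
Context {K : numFieldType} {V : lmodType K}.
Implicit Types (A : {linear V -> V}) (p P Q : {poly K}) (a : nat -> K).

(* Operators are added and scaled in the K-vector space of all functions
   V -> V; their product is the composition [\o]. *)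
Definition poly_op p A : V -> V := \sum_(r < size p) p`_r *: iter r A.

Definition poly_alg A : set (V -> V) := [set B | exists p, B = poly_op p A].

Definition is_series_op a A (B : V -> V) : Prop :=
  fd_cvg (poly_alg A) (series (fun r => a r *: (iter r A : V -> V))) B.

(* [Q(A)] is invertible and [B = P(A) Q(A)^-1]. *)
Definition is_quotient_op P Q A (B : V -> V) : Prop :=
  exists S : V -> V,
    [/\ cancel (poly_op Q A) S, cancel S (poly_op Q A) & B = poly_op P A \o S].

End Operators.

(* F is the entire function with power series [\sum_r a_r x^r], convergent on
   the whole of K. *)
Definition entire_with (K : numFieldType) (a : nat -> K) (F : K -> K) : Prop :=
  forall x : K, series (fun r => a r * x ^+ r) @ \oo --> F x.

(* The sum of the terms of degree < m of the Taylor series of F at l; the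
   derivatives are iterated limits of difference quotients over K. *)
Definition taylor_poly (K : numFieldType) (F : K -> K) (l : K) (m : nat) :
    {poly K} :=
  \sum_(p < m) (derive1n p F l / p`!%:R)%:P * ('X - l%:P) ^+ p.

Definition is_principal_resolvent (K : numFieldType) (k : nat)
    (lam : 'I_k -> K) (m : 'I_k -> nat) (i : 'I_k) (p : {poly K}) : Prop :=
  [/\ (size p <= \sum_(j < k) m j)%N,
      p.[lam i] = 1,
      forall q : nat, (1 <= q < m i)%N -> (p^`(q)).[lam i] = 0 &
      forall j : 'I_k, j != i ->
        forall q : nat, (q < m j)%N -> (p^`(q)).[lam j] = 0].

(* The unique such polynomial; the default 0 is never used when lam is
   injective and the multiplicities m are positive. *)
Definition principal_resolvent (K : numFieldType) (k : nat)
    (lam : 'I_k -> K) (m : 'I_k -> nat) (i : 'I_k) : {poly K} :=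
  xget 0 [set p | is_principal_resolvent lam m i p].

Definition taylor_resolvent_sum (K : numFieldType) (V : lmodType K)
    (A : {linear V -> V}) (k : nat) (lam : 'I_k -> K) (m : 'I_k -> nat)
    (F : K -> K) : V -> V :=
  \sum_(i < k) (poly_op (taylor_poly F (lam i) (m i)) A
                  \o poly_op (principal_resolvent lam m i) A).

(* Main.v *)
Require Import Defs.
From HB Require Import structures.
From mathcomp Require Import all_boot all_order all_algebra.
From mathcomp Require Import all_classical all_reals all_analysis.
From mathcomp Require Import complex ring.

Set Implicit Arguments.
Unset Strict Implicit.
Unset Printing Implicit Defensive.

Import Order.TTheory GRing.Theory Num.Theory numFieldNormedType.Exports.

Local Open Scope classical_set_scope.
Local Open Scope ring_scope.

(**
Write N for the product of the ('X - lam_i)^(m_i), and L_i for the principal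
resolvents. Over an algebraically closed field T divides N, so N(A) = 0 and
poly_op sends polynomials congruent modulo N to the same operator. Everything
rests on one congruence [dvdp_sub_resolvent_sum]: if g agrees with G_i modulo
('X - lam_i)^(m_i) for every i, then g agrees with the sum of the G_i L_i
modulo N, because L_i is 1 at lam_i and 0 at the other lam_j to the relevant
orders. Divisibility by ('X - lam)^m and vanishing of the first m derivatives
at lam are the same thing [dvdp_XsubCXP].

Rational functions. The Taylor polynomial t_i of P/Q at lam_i satisfies
Q t_i = P modulo ('X - lam_i)^(m_i) [dvdp_taylor_quotient]. The congruence,
applied to g = P and G_i = Q t_i, says that Q H = P modulo N, where H is the sum
of the t_i L_i. Since Q is invertible modulo N, H(A) = P(A) Q(A)^-1.

Entire functions. Taking for G_i the Taylor polynomial of g itself, the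
congruence writes g(A), for every polynomial g, as a combination of the finitely
many operators (A - lam_i)^p L_i(A), p < m_i, with coefficients
g^(p)(lam_i) / p!. So these operators span C[A], and for the partial sums g of
the power series of F the coefficients tend to F^(p)(lam_i) / p!, because a
power series that converges everywhere may be differentiated term by term
[cvg_derivn_partial_sum]. The spanning operators may be linearly dependent (T
need not be the minimal polynomial of A), but convergence of the coefficients
along a spanning family gives convergence of the coordinates in a basis
[fd_cvg_span].
*)

(** * Taylor polynomials and divisibility by powers of ['X - l] *)

Section TaylorPolynomials.
Context {K : numFieldType}.
Implicit Types (g h : {poly K}) (l : K) (m q : nat).

Lemma dvdp_deriv_XsubCX g l m :
  ('X - l%:P) ^+ m.+1 %| g -> ('X - l%:P) ^+ m %| g^`().
Proof.
case/dvdpP=> w ->; rewrite derivM deriv_exp derivXsubC mul1r.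
apply: dvdp_add; first by rewrite exprS mulrA dvdp_mulIr.
by rewrite mulrnAr -mulrnAl dvdp_mulIr.
Qed.

Lemma dvdp_derivn_XsubCX g l m q :
  ('X - l%:P) ^+ m %| g -> ('X - l%:P) ^+ (m - q) %| g^`(q).
Proof.
move=> dvd; elim: q => [|q IHq]; first by rewrite subn0.
rewrite derivnS subnS; case E: (m - q)%N => [|r]; first by rewrite dvd1p.
by apply: dvdp_deriv_XsubCX; rewrite -E.
Qed.

Lemma root_derivn_XsubCX g l m q :
  ('X - l%:P) ^+ m %| g -> (q < m)%N -> (g^`(q)).[l] = 0.
Proof.
move=> /(dvdp_derivn_XsubCX q) dvd ltqm; apply/rootP.
rewrite -dvdp_XsubCl; apply: dvdp_trans dvd.
by rewrite -(subnSK ltqm) exprS dvdp_mulIl.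
Qed.

(** [taylor_poly F l m] is the instance of this whose [c] lists the iterated
    derivatives of [F] at [l]; leaving [c] free lets formal derivatives of
    polynomials be used as well. *)
Definition jet (c : nat -> K) l m : {poly K} :=
  \sum_(p < m) (c p / p`!%:R)%:P * ('X - l%:P) ^+ p.

(** In the Taylor expansion of [g] at [l], the terms of degree at least [m] are
    all divisible by [('X - l) ^+ m]. *)
Lemma dvdp_sub_jet g l m :
  ('X - l%:P) ^+ m %| g - jet (fun p => (g^`(p)).[l]) l m.
Proof.
(* The expansion is written up to a length that is at least [m], so that the
   jet is an initial segment of it. *)
pose n := maxn m (size g).
have g_taylor : g =
    \sum_(0 <= p < n) ((g^`(p)).[l] / p`!%:R)%:P * ('X - l%:P) ^+ p.
  (* Taylor's formula in {poly K}: evaluate [g] at 'X = l + ('X - l). *)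
  rewrite -{1}[g]comp_polyXr /comp_poly -{1}['X](subrKC l%:P).
  have := @nderiv_taylor_wide _ n (map_poly polyC g) l%:P ('X - l%:P).
  rewrite size_map_polyC leq_maxr => -> //; last exact: mulrC.
  rewrite big_mkord; apply: eq_bigr => i _.
  rewrite nderivn_map horner_map /= nderivn_def hornerMn -[_ *+ _]mulr_natr.
  by rewrite mulfK // pnatr_eq0 -lt0n fact_gt0.
rewrite {1}g_taylor (big_cat_nat (n := m)) //= ?leq_maxl //.
rewrite /jet big_mkord addrAC subrr add0r big_nat.
apply: (big_ind (fun p => _ %| p)) => [||i /andP[le_mi _]].
- exact: dvdp0.
- exact: dvdp_add.
by rewrite -(subnKC le_mi) exprD mulrCA dvdp_mulIl.
Qed.

Lemma dvdp_XsubCXP g l m :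
  ('X - l%:P) ^+ m %| g <-> forall q, (q < m)%N -> (g^`(q)).[l] = 0.
Proof.
split=> [dvd q|g0]; first exact: root_derivn_XsubCX.
have := dvdp_sub_jet g l m; rewrite /jet big1 ?subr0 // => i _.
by rewrite g0 // mul0r mul0r.
Qed.

End TaylorPolynomials.

(** * Principal Lagrange resolvents *)

Lemma dvdp_modp_sub (K : fieldType) (p d : {poly K}) : d %| p %% d - p.
Proof.
rewrite [X in _ - X](divp_eq p d) opprD addrCA subrr addr0.
by rewrite dvdpNr dvdp_mulIr.
Qed.

Section Resolvents.
Context {K : numFieldType} {k : nat}.
Variables (lam : 'I_k -> K) (m : 'I_k -> nat).
Hypothesis lam_inj : injective lam.
Implicit Types (i j : 'I_k) (g p : {poly K}) (G : 'I_k -> {poly K}).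

Local Notation "''m_' i" := (('X - (lam i)%:P) ^+ m i)
  (at level 8, i at level 2, format "''m_' i").

Lemma coprimep_XsubCX i j : i != j -> coprimep 'm_i 'm_j.
Proof.
move=> neq_ij; apply/coprimep_expl/coprimep_expr.
rewrite coprimep_XsubC root_XsubC; apply: contra neq_ij => /eqP.
by move/lam_inj->.
Qed.

Lemma coprimep_prod_XsubCX i (s : seq 'I_k) :
  i \notin s -> coprimep 'm_i (\prod_(j <- s) 'm_j).
Proof.
move=> s'i; rewrite big_seq; apply: (big_ind (coprimep _)) => [|p q cp cq|j s_j].
- exact: coprimep1.
- by rewrite coprimepMr cp.
- by apply: coprimep_XsubCX; apply: contraNneq s'i => ->.
Qed.

Lemma dvdp_prod_XsubCX g :
  (forall i, 'm_i %| g) -> \prod_i 'm_i %| g.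
Proof.
move=> dvd; elim: (index_enum _) (index_enum_uniq 'I_k) => [|i s IHs] /=.
  by rewrite big_nil dvd1p.
case/andP=> s'i uniq_s; rewrite big_cons Gauss_dvdp ?dvd ?IHs //.
exact: coprimep_prod_XsubCX.
Qed.

Lemma size_prod_XsubCX : size (\prod_i 'm_i) = (\sum_i m i).+1.
Proof.
rewrite size_prod => [|i _]; last by rewrite expf_neq0 // polyXsubC_eq0.
rewrite (eq_bigr (fun i => (m i).+1)) => [|i _]; last first.
  by rewrite size_exp_XsubC.
under eq_bigr do rewrite -addn1.
by rewrite big_split /= sum1_card -addSn addnK.
Qed.

(** Derivative conditions at the nodes are congruences. A zero multiplicity is
    excluded because the condition on the value at [lam i] is not subject to
    the multiplicity. *)
Lemma is_principal_resolventP i p : (0 < m i)%N ->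
  is_principal_resolvent lam m i p <->
  [/\ (size p <= \sum_j m j)%N, 'm_i %| p - 1 & forall j, j != i -> 'm_j %| p].
Proof.
move=> m_gt0; split=> [[sz_p p1 p0 p0']|[sz_p dvd1 dvd0]].
  split=> // [|j neq_ji]; apply/dvdp_XsubCXP; last exact: p0'.
  case=> [|q] lt_qm; first by rewrite derivn0 hornerD p1 hornerN hornerC subrr.
  by rewrite derivnB derivnC subr0 p0.
split=> // [|q /andP[q_gt0 lt_qm]|j neq_ji]; last first.
- exact/dvdp_XsubCXP/dvd0.
- have/dvdp_XsubCXP/(_ q lt_qm) := dvd1.
  by rewrite derivnB derivnC gtn_eqF // subr0.
- have/dvdp_XsubCXP/(_ 0 m_gt0)/eqP := dvd1.
  by rewrite derivn0 !hornerE subr_eq0 => /eqP.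
Qed.

(** Chinese remainders: a Bezout relation between [('X - lam_i)^(m_i)] and the
    product of the other factors gives a solution of the congruences, which is
    then reduced modulo the full product to bring down its degree. *)
Lemma principal_resolvent_exists i : (0 < m i)%N ->
  exists p, is_principal_resolvent lam m i p.
Proof.
move=> m_gt0; pose N := \prod_j 'm_j.
have N_i j : 'm_j %| N by rewrite /N (bigD1 j) //= dvdp_mulIl.
have cop : coprimep (\prod_(j <- rem i (index_enum 'I_k)) 'm_j) 'm_i.
  rewrite coprimep_sym coprimep_prod_XsubCX //.
  by rewrite mem_rem_uniq ?index_enum_uniq // inE eqxx.
have [[u v] /= uv1] := Bezout_eq1_coprimepP _ _ cop.
set p0 := u * _ in uv1.
have N_neq0 : N != 0 by rewrite -size_poly_gt0 size_prod_XsubCX.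
have dvd_p0 j : 'm_j %| p0 %% N - p0 := dvdp_trans (N_i j) (dvdp_modp_sub _ _).
exists (p0 %% N); apply/is_principal_resolventP => //; split=> [||j neq_ji].
- by rewrite -ltnS -size_prod_XsubCX ltn_modp.
- rewrite -(subrK p0 (p0 %% N)) -addrA dvdp_addr //.
  by rewrite -uv1 opprD addrA subrr sub0r dvdpNr dvdp_mulIr.
- rewrite -(subrK p0 (p0 %% N)) dvdp_addr //.
  rewrite dvdp_mull // (bigD1_seq j) ?rem_uniq ?index_enum_uniq //=.
    by rewrite dvdp_mulIl.
  by rewrite mem_rem_uniq ?index_enum_uniq // inE neq_ji mem_index_enum.
Qed.

Lemma principal_resolventP i : (0 < m i)%N ->
  is_principal_resolvent lam m i (principal_resolvent lam m i).
Proof. by move=> m_gt0; apply: xgetPex (principal_resolvent_exists m_gt0). Qed.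

(** Modulo [('X - lam_j)^(m_j)] the sum collapses to its [j]-th term, which is
    [G j]. *)
Lemma dvdp_sub_resolvent_sum g G : (forall i, 0 < m i)%N ->
  (forall i, 'm_i %| g - G i) ->
  \prod_i 'm_i %| g - \sum_i G i * principal_resolvent lam m i.
Proof.
move=> m_gt0 dvd; apply: dvdp_prod_XsubCX => j; rewrite (bigD1 j) //=.
have [_ dvd1 _] := (is_principal_resolventP _ (m_gt0 j)).1
  (principal_resolventP (m_gt0 j)).
set L := principal_resolvent _ _ _ in dvd1 *.
rewrite opprD addrA dvdp_sub //.
  have -> : g - G j * L = (g - G j) - G j * (L - 1) by ring.
  by rewrite dvdp_sub // dvdp_mull.
apply: (big_ind (fun p => _ %| p)) => [||i neq_ij].
- exact: dvdp0.
- by move=> p q; apply: dvdp_add.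
have [_ _ dvd0] := (is_principal_resolventP _ (m_gt0 i)).1
  (principal_resolventP (m_gt0 i)).
by rewrite dvdp_mull // dvd0 // eq_sym.
Qed.

End Resolvents.

(** The cofactor of the product in [T] has no root, as a root would raise the
    multiplicity of some [lam i]; so over a closed field it is a constant. *)
Lemma dvdp_closed_prod_XsubCX (K : numClosedFieldType) (T : {poly K}) k
    (lam : 'I_k -> K) :
  T != 0 -> injective lam ->
  (forall x, root T x -> exists i, x = lam i) ->
  T %| \prod_i ('X - (lam i)%:P) ^+ mup (lam i) T.
Proof.
move=> T_neq0 lam_inj lam_roots; set N := \prod_i _.
have /dvdpP[W defT] : N %| T.
  by apply: dvdp_prod_XsubCX => // i; rewrite -mup_geq.
have W_root x : ~~ root W x.
  apply/negP=> Wx; have [|i def_x] := lam_roots x.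
    by rewrite defT rootM Wx.
  have := mup_leq (lam i) (mup (lam i) T) T_neq0.
  rewrite leqnn => /esym/negP; apply.
  rewrite {2}defT exprS dvdp_mul ?dvdp_XsubCl -?def_x //.
  by rewrite def_x /N (bigD1 i) //= dvdp_mulIl.
have W1 : size W = 1.
  by apply/eqP/negbNE/negP => /closed_rootP[x Wx]; case/negP: (W_root x).
have /eqP := W1; rewrite size_poly_eq1 => W_eq1.
by rewrite defT (eqp_dvdl _ (eqp_mulr _ W_eq1)) mul1r.
Qed.
(** * Polynomials in an operator *)

Section PolynomialCalculus.
Context {K : numFieldType} {V : lmodType K}.
Variable A : {linear V -> V}.
Implicit Types (p q : {poly K}) (v : V).

Lemma poly_opE n p v : (size p <= n)%N ->
  poly_op p A v = \sum_(r < n) p`_r *: iter r A v.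
Proof.
move=> le_pn; rewrite /poly_op fct_sumE.
rewrite (big_ord_widen _ (fun r => (p`_r *: iter r A) v) le_pn) big_mkcond.
apply: eq_bigr => i _; case: ltnP => // le_pi.
by rewrite nth_default // scale0r.
Qed.

Lemma poly_opD p q : poly_op (p + q) A = poly_op p A + poly_op q A.
Proof.
apply/funext => v; rewrite fctE.
have le_n := size_polyD p q; set n := maxn _ _ in le_n.
rewrite (poly_opE _ le_n) (@poly_opE n p) ?leq_maxl //.
rewrite (@poly_opE n q) ?leq_maxr //.
by rewrite -big_split; apply: eq_bigr => i _; rewrite coefD scalerDl.
Qed.

Lemma poly_opZ c p : poly_op (c *: p) A = c *: poly_op p A.
Proof.
apply/funext => v; rewrite fctE.
rewrite (poly_opE _ (size_scale_leq c p)) (@poly_opE (size p)) // scaler_sumr.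
by apply: eq_bigr => i _; rewrite coefZ scalerA.
Qed.

Lemma poly_op0 : poly_op 0 A = 0.
Proof. by rewrite -(scale0r 0) poly_opZ scale0r. Qed.

Lemma poly_op_sum I (s : seq I) (P : pred I) (p : I -> {poly K}) :
  poly_op (\sum_(i <- s | P i) p i) A = \sum_(i <- s | P i) poly_op (p i) A.
Proof.
apply: (big_morph (fun p => poly_op p A)); [exact: poly_opD | exact: poly_op0].
Qed.

Lemma poly_opMX p v : poly_op (p * 'X) A v = poly_op p A (A v).
Proof.
rewrite (@poly_opE (size p).+1) ?size_polyMleq; last first.
  by rewrite (leq_trans (size_polyMleq _ _)) // size_polyX addn2.
rewrite big_ord_recl coefMX scale0r add0r (@poly_opE (size p)) //.
by apply: eq_bigr => i _; rewrite coefMX -iterSr.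
Qed.

Lemma poly_opC c v : poly_op c%:P A v = c *: v.
Proof. by rewrite (poly_opE v (size_polyC_leq1 c)) big_ord1 coefC. Qed.

Lemma poly_opM p q : poly_op (p * q) A = poly_op p A \o poly_op q A.
Proof.
elim/poly_ind: q => [|q c IHq]; apply/funext => v /=.
  rewrite mulr0 poly_op0 (@poly_opE (size p)) // big1 // => i _.
  by rewrite iter_fix ?raddf0 ?scaler0.
rewrite mulrDr mulrA !poly_opD !fctE poly_opMX IHq /= poly_opMX poly_opC.
rewrite mulrC mul_polyC poly_opZ fctE; move: (poly_op q A (A v)) => w.
rewrite !(@poly_opE (size p)) //.
rewrite scaler_sumr -big_split; apply: eq_bigr => i _ /=.
have iterL : forall x y, iter i A (x + c *: y) = iter i A x + c *: iter i A y.
  by move=> x y; elim: (nat_of_ord i) => //= r ->; rewrite linearD linearZ.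
by rewrite iterL scalerDr !scalerA mulrC.
Qed.

Lemma poly_op_dvdp0 p q : p %| q -> poly_op p A = 0 -> poly_op q A = 0.
Proof. by case/dvdpP=> u -> pA0; rewrite mulrC poly_opM pA0. Qed.

Lemma poly_op_eqmod T p q : poly_op T A = 0 -> T %| p - q ->
  poly_op p A = poly_op q A.
Proof.
move=> TA0 dvd; rewrite -(subrK q p) poly_opD.
by rewrite (poly_op_dvdp0 dvd) // add0r.
Qed.

Lemma series_poly_op (a : nat -> K) n :
  series (fun r => a r *: (iter r A : V -> V)) n =
  poly_op (\poly_(r < n) a r) A.
Proof.
rewrite /series /= big_mkord; apply/funext => v.
rewrite (@poly_opE n) ?size_poly // fct_sumE; apply: eq_bigr => i _.
by rewrite coef_poly ltn_ord fctE.
Qed.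

End PolynomialCalculus.

(** * Convergence in a finitely generated space *)

Section Span.
Context {K : numFieldType} {W : lmodType K}.

Definition span_set (I : finType) (e : I -> W) : set W :=
  [set w | exists c : I -> K, w = \sum_i c i *: e i].

(** A spanning family of least length is free: in a nontrivial relation some
    vector would be a combination of the others and could be dropped. *)
Lemma span_set_basis (I : finType) (e : I -> W) :
  exists d' (b : 'I_d' -> W), is_basis (span_set e) b.
Proof.
pose spanned d' := exists b : 'I_d' -> W, span_set b = span_set e.
have ex : exists d', `[<spanned d'>].
  exists #|I|; apply/asboolP; exists (e \o enum_val); apply/seteqP.
  split=> w [c ->] /=.
    exists (c \o enum_rank); rewrite (reindex _ (onW_bij _ (@enum_val_bij I))).
    by apply: eq_bigr => i _; rewrite /= enum_valK.
  exists (c \o enum_val).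
  by rewrite (reindex _ (onW_bij _ (@enum_val_bij I))).
case: (ex_minnP ex) => d' /asboolP[b def_b] min_d'.
exists d', b; split=> [|c c0 i]; first by rewrite -def_b.
case: d' b def_b min_d' c c0 i => [|d'] b def_b min_d' c c0 i; first by case: i.
apply: contrapT => /eqP ci_neq0; have /negP := ltnn d'; apply; apply: min_d'.
apply/asboolP; exists (b \o lift i); rewrite -def_b; apply/seteqP.
have bi : b i = \sum_j (- (c i)^-1 * c (lift i j)) *: b (lift i j).
  move/eqP: c0; rewrite (bigD1_ord i) //= addr_eq0 => /eqP ci.
  rewrite -[LHS]scale1r -(mulVf ci_neq0) -scalerA ci scalerN -scaleNr scaler_sumr.
  by apply: eq_bigr => j _; rewrite scalerA.
split=> w [u ->] /=; last first.
  exists (fun j => u i * (- (c i)^-1 * c (lift i j)) + u (lift i j)).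
  rewrite (bigD1_ord i) //= bi scaler_sumr -big_split; apply: eq_bigr => j _ /=.
  by rewrite scalerDl scalerA.
exists (fun l => if unlift i l is Some j then u j else 0).
rewrite (bigD1_ord i) //= unlift_none scale0r add0r.
by apply: eq_bigr => j _; rewrite liftK.
Qed.

(** The coordinates in a basis are fixed linear combinations of the
    coefficients along [e], hence converge with them, whether or not [e] is
    free. *)
Lemma fd_cvg_span (J : finType) (e : J -> W) (c : nat -> J -> K) (l : J -> K) :
  (forall j, c n j @[n --> \oo] --> l j) ->
  fd_cvg (span_set e) (fun n => \sum_j c n j *: e j) (\sum_j l j *: e j).
Proof.
move=> cl; have [d' [b b_basis]] := span_set_basis e.
have /choice[M e_b] j : exists r : 'I_d' -> K, e j = \sum_i r i *: b i.
  suff : span_set e (e j) by rewrite (proj1 b_basis).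
  exists (fun i => (i == j)%:R); rewrite (bigD1 j) //= eqxx scale1r big1 ?addr0 //.
  by move=> i /negPf->; rewrite scale0r.
have sumE u : \sum_j u j *: e j = \sum_i (\sum_j u j * M j i) *: b i.
  under [RHS]eq_bigr do rewrite scaler_suml.
  rewrite exchange_big; apply: eq_bigr => j _ /=; rewrite {1}e_b scaler_sumr.
  by apply: eq_bigr => i _; rewrite scalerA.
exists d', b, (fun n i => \sum_j c n j * M j i), (fun i => \sum_j l j * M j i).
split=> // i; apply: cvg_big => [|j _]; first exact: add_continuous.
by apply: cvgM; [exact: cl | exact: cvg_cst].
Qed.

End Span.
(** * Termwise differentiation of entire power series *)

Section PowerSeriesEstimates.
Context {K : numFieldType}.
Implicit Types (a : nat -> K) (F : K -> K) (x h : K).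

Lemma derive1_quadratic F x d C :
  (forall h, `|h| <= 1 -> `|F (x + h) - F x - h * d| <= C * `|h| ^+ 2) ->
  derive1 F x = d.
Proof.
move=> quad; have C_ge0 : 0 <= C.
  (* The case [h = 1] of the estimate. *)
  by have := quad 1; rewrite normr1 expr1n mulr1 => /(_ (lexx _)); apply: le_trans.
apply: cvg_lim => //; apply/cvgrPdist_le => e e_gt0.
have C1_gt0 : 0 < C + 1 by rewrite ltr_wpDl.
have : \forall h \near (0 : K)^', `|h| <= 1.
  apply: dnbhs0_le; exact: ltr01.
have : \forall h \near (0 : K)^', `|h| <= e / (C + 1).
  by apply: dnbhs0_le; rewrite divr_gt0.
apply: filter_app2.
have : \forall h \near (0 : K)^', h != 0 by exact: nbhs_dnbhs_neq.
apply: filterS => h h_neq0 le_he le_h1.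
have -> : d - h^-1 *: (F (h + x) - F x) = - h^-1 * (F (x + h) - F x - h * d).
  by rewrite /GRing.scale /= (addrC h); field.
rewrite normrM normrN normfV ler_pdivrMl ?normr_gt0 //.
apply: le_trans (quad h le_h1) _; rewrite expr2 mulrA mulrC.
apply: ler_wpM2l => //; apply: le_trans (ler_wpM2l C_ge0 le_he) _.
by rewrite mulrCA ler_piMr ?(ltW e_gt0) // ler_pdivrMr // mul1r lerDl ler01.
Qed.

(** The order of [K] is only partial, so the usual passage to the limit in an
    inequality is redone here, for norms. *)
Lemma cvg_norm_le (u : nat -> K) (l b : K) :
  u n @[n --> \oo] --> l -> (forall n, `|u n| <= b) -> `|l| <= b.
Proof.
move=> ul ub; have b_real : b \is Num.real.
  by apply: ger0_real; apply: le_trans (ub 0).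
rewrite real_leNgt ?normr_real //; apply/negP => lt_bl.
have e_gt0 : 0 < `|l| - b by rewrite subr_gt0.
have /cvgrPdist_lt/(_ _ e_gt0)[N _ /(_ N (leqnn N))] := ul.
rewrite ltrBrDr => lt_l.
have := le_lt_trans (lerD (lexx _) (ub N)) lt_l.
by move/(le_lt_trans (ler_normD _ _)); rewrite subrK ltxx.
Qed.

Lemma mulrn_expr_le (y : K) r : 0 <= y -> r.+1%:R * y ^+ r <= (y + 1) ^+ r.+1.
Proof.
move=> y_ge0; elim: r => [|r IHr]; first by rewrite mulr1 expr1 lerDr.
rewrite -natr1 mulrDl mul1r exprS mulrCA [leRHS]exprS [leRHS]mulrDl mul1r.
apply: lerD; first exact: ler_wpM2l.
rewrite -exprS; apply: lerXn2r; rewrite ?nnegrE ?addr_ge0 //.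
by rewrite lerDl.
Qed.

(** The estimate has the factor [`|h| ^+ 2] and otherwise grows only
    geometrically in [r], so that it can be summed against the coefficients of
    an entire series. The remainders satisfy
    [D_(r+1) = (x + h) * D_r + r * h^2 * x^(r-1)]. *)
Lemma exprD_remainder_le x h r : `|h| <= 1 ->
  `|(x + h) ^+ r - x ^+ r - h * (r%:R * x ^+ r.-1)| <=
    `|h| ^+ 2 * (`|x| + 2) ^+ r.
Proof.
move=> h1; elim: r => [|r IHr].
  by rewrite !expr0 mul0r mulr0 subrr subr0 normr0 mulr1 exprn_ge0.
have -> : (x + h) ^+ r.+1 - x ^+ r.+1 - h * (r.+1%:R * x ^+ r.+1.-1) =
    (x + h) * ((x + h) ^+ r - x ^+ r - h * (r%:R * x ^+ r.-1)) +
    h ^+ 2 * (r%:R * x ^+ r.-1).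
  by case: r {IHr} => [|r]; rewrite /= -?natr1 !exprS; ring.
apply: le_trans (ler_normD _ _) _; rewrite !normrM !normrX normr_nat -[`|h| * `|h|]expr2.
have -> : `|h| ^+ 2 * (`|x| + 2) ^+ r.+1 =
    (`|x| + 1) * (`|h| ^+ 2 * (`|x| + 2) ^+ r) + `|h| ^+ 2 * (`|x| + 2) ^+ r.
  by rewrite [_ ^+ r.+1]exprS; ring.
apply: lerD.
  apply: ler_pM => //; apply: le_trans (ler_normD _ _) _.
  exact: lerD.
apply: ler_wpM2l; first exact: exprn_ge0.
apply: (@le_trans _ _ ((`|x| + 1) ^+ r)).
  by case: r {IHr} => [|r]; rewrite ?mul0r ?exprn_ge0 ?addr_ge0 ?mulrn_expr_le.
by apply: lerXn2r; rewrite ?nnegrE ?addr_ge0 // lerD2l ler1n.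
Qed.

Definition diffs a : nat -> K := fun r => r.+1%:R * a r.+1.

Lemma deriv_poly_diffs a n :
  (\poly_(r < n.+1) a r)^`() = \poly_(r < n) diffs a r.
Proof.
apply/polyP => r; rewrite coef_deriv !coef_poly ltnS.
by case: ltnP => _; rewrite ?mul0rn // /diffs mulr_natl.
Qed.

Lemma entire_coef_bound a F (rho : K) : entire_with a F -> 0 <= rho ->
  exists M, forall r, `|a r| * rho ^+ r <= M.
Proof.
move=> aF rho_ge0; have cvg_a : cvgn (series (fun r => a r * rho ^+ r)).
  by apply/cvg_ex; exists (F rho); apply: aF.
have /cvg_seq_bounded[M0 [M0_real bnd]] : cvgn (fun r => a r * rho ^+ r).
  by apply/cvg_ex; exists 0; exact: cvg_series_cvg_0 cvg_a.
exists (M0 + 1) => r; have := bnd (M0 + 1); rewrite ltrDl ltr01 => /(_ isT r I).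
by rewrite /= normrM normrX (ger0_norm rho_ge0).
Qed.

Lemma sum_half_le n : \sum_(r < n) (2%:R : K) ^- r <= 2.
Proof.
have -> : \sum_(r < n) (2%:R : K) ^- r = 2 - 2 * 2 ^- n.
  elim: n => [|n IHn]; first by rewrite big_ord0 expr0 invr1; ring.
  rewrite big_ord_recr /= IHn exprS; field.
  by rewrite expf_neq0 // pnatr_eq0.
by rewrite gerBl mulr_ge0 ?invr_ge0 ?exprn_ge0.
Qed.

(** The terms of the series are bounded at [2 * rho], hence decrease
    geometrically at [rho]. *)
Lemma entire_coef_geometric a F (rho : K) : entire_with a F -> 0 <= rho ->
  exists M, 0 <= M /\ forall r, `|a r| * rho ^+ r <= M * 2 ^- r.
Proof.
move=> aF rho_ge0.
have [|M aM] := @entire_coef_bound a F (2 * rho) aF; first exact: mulr_ge0.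
exists M; split; first by apply: le_trans (aM 0); rewrite mulr_ge0 ?exprn_ge0 ?mulr_ge0.
move=> r; rewrite ler_pdivlMr ?exprn_gt0 //; apply: le_trans (aM r).
by rewrite exprMn -mulrA [rho ^+ r * _]mulrC.
Qed.

(** The partial sums satisfy a second-order estimate whose constant does not
    depend on [n], so it survives in the limit. *)
Lemma entire_remainder_le a F x : entire_with a F ->
  exists C, forall n h, `|h| <= 1 ->
    `|series (fun r => a r * (x + h) ^+ r) n.+1
      - series (fun r => a r * x ^+ r) n.+1
      - h * series (fun r => diffs a r * x ^+ r) n| <= C * `|h| ^+ 2.
Proof.
move=> aF; have rho_ge0 : 0 <= `|x| + 2 by rewrite addr_ge0.
have [M [M_ge0 aM]] := entire_coef_geometric aF rho_ge0.
exists (M * 2) => n h h1.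
rewrite /series /= !big_mkord [\sum_(i < n) _](_ : _ =
    \sum_(r < n.+1) a r * (r%:R * x ^+ r.-1)); last first.
  rewrite big_ord_recl mul0r mulr0 add0r; apply: eq_bigr => i _.
  by rewrite /diffs /= mulrCA mulrA.
rewrite mulr_sumr -!sumrB.
apply: le_trans (ler_norm_sum _ _ _) _.
apply: (@le_trans _ _ (\sum_(r < n.+1) M * `|h| ^+ 2 * 2 ^- r)); last first.
  rewrite -mulr_sumr -mulrA [leRHS]mulrAC -mulrA; apply: ler_wpM2l => //.
  by apply: ler_wpM2l; [exact: exprn_ge0 | exact: sum_half_le].
apply: ler_sum => r _; rewrite -mulrBr mulrCA -mulrBr normrM.
apply: le_trans (ler_wpM2l (normr_ge0 _) (exprD_remainder_le x r h1)) _.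
by rewrite mulrCA [leRHS]mulrAC [leRHS]mulrC; apply: ler_wpM2l; rewrite ?exprn_ge0.
Qed.

(** The hypothesis on [F'] isolates the one place where completeness of the
    field enters: convergence of the differentiated series. *)
Lemma entire_derive1 a F F' : entire_with a F -> entire_with (diffs a) F' ->
  derive1 F = F'.
Proof.
move=> aF aF'; apply/funext => x; have [C rem] := entire_remainder_le x aF.
apply: (derive1_quadratic (C := C)) => h h1.
apply: (cvg_norm_le _ (fun n => rem n h h1)).
apply: cvgB; last by apply: cvgM; [exact: cvg_cst | exact: aF'].
apply: cvgB; [have := aF (x + h) | have := aF x]; by rewrite -cvg_shiftS.
Qed.

End PowerSeriesEstimates.
Section ComplexSeries.
Context {R : realType}.
Local Notation K := (Cplx R).

Lemma normc_ge_Im (x : R[i]) : `|complex.Im x|%:C%C <= `|x|.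
Proof.
case: x => a b; rewrite normc_def /= lecR -sqrtr_sqr ler_wsqrtr //.
by rewrite lerDr sqr_ge0.
Qed.

Lemma normc_le_ReIm (x : R[i]) :
  `|x| <= (`|complex.Re x| + `|complex.Im x|)%:C%C.
Proof.
case: x => a b; rewrite normc_def /= lecR.
rewrite -(ger0_norm (addr_ge0 (normr_ge0 a) (normr_ge0 b))) -sqrtr_sqr.
apply: ler_wsqrtr; rewrite sqrrD !real_normK ?num_real //.
by rewrite addrAC lerDl mulrn_wge0 // mulr_ge0.
Qed.

(** Dominated series of complex numbers converge because their real and
    imaginary parts do. *)
Lemma cvg_series_dominated (u : nat -> K) (b : nat -> R) :
  (forall n, `|u n| <= (b n)%:C%C) -> cvgn (series b) -> cvgn (series u).
Proof.
move=> ub cvg_b.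
have dominated (f : nat -> R) :
    (forall n, `|f n|%:C%C <= `|u n|) -> cvgn (series f).
  move=> fu; apply: normed_cvg; apply: series_le_cvg cvg_b => n //=.
    by rewrite -lecR; apply: le_trans (normr_ge0 (u n)) (ub n).
  by rewrite -lecR; apply: le_trans (fu n) (ub n).
have xl : cvgn (series (fun n => complex.Re (u n))).
  by apply: dominated => n; exact: normc_ge_Re.
have yl : cvgn (series (fun n => complex.Im (u n))).
  by apply: dominated => n; exact: normc_ge_Im.
set lx := limn _ in xl; set ly := limn _ in yl.
apply/cvg_ex; exists (lx +i* ly)%C; apply/cvgrPdist_lt => e e_gt0.
have [e' def_e] := complex_realP _ (gtr0_real e_gt0).
move: e_gt0; rewrite {}def_e ltcR => e'_gt0.
have e2_gt0 : 0 < e' / 2 by rewrite divr_gt0.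
have /cvgrPdist_lt/(_ _ e2_gt0) := xl; have /cvgrPdist_lt/(_ _ e2_gt0) := yl.
apply: filterS2 => n ltx lty.
have -> : series u n = (series (fun n => complex.Re (u n)) n +i*
                        series (fun n => complex.Im (u n)) n)%C.
  by apply/eqP; rewrite eq_complex /series /= !raddf_sum !eqxx.
apply: le_lt_trans (normc_le_ReIm _) _; rewrite ltcR [e']splitr addrC /=.
exact: ltrD.
Qed.

(** The factor [r.+1] of the differentiated series is absorbed by replacing
    [`|x|] with [`|x| + 1] [mulrn_expr_le], where the terms of the given series
    still decrease geometrically. *)
Lemma entire_diffs (a : nat -> K) (F : K -> K) : entire_with a F ->
  entire_with (diffs a) (derive1 F).
Proof.
move=> aF.
have cvg_diffs x : cvgn (series (fun r => diffs a r * x ^+ r)).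
  have rho_ge0 : 0 <= `|x| + 1 by rewrite addr_ge0.
  have [M [M_ge0 aM]] := entire_coef_geometric aF rho_ge0.
  have [M' def_M] := complex_realP _ (ger0_real M_ge0).
  apply: (@cvg_series_dominated _ (geometric M' 2^-1)); last first.
    by apply: is_cvg_geometric_series; rewrite gtr0_norm ?invr_gt0 ?invf_lt1 ?ltr1n.
  move=> r; apply: (@le_trans _ _ (M * 2 ^- r)); last first.
    by rewrite def_M /geometric /= rmorphM rmorphXn fmorphV rmorph_nat exprVn.
  apply: (@le_trans _ _ (M * 2 ^- r.+1)); last first.
    by rewrite ler_wpM2l // lef_pV2 ?posrE ?exprn_gt0 // ler_eXn2l ?ltr1n.
  apply: le_trans (aM r.+1); rewrite /diffs mulrAC mulrC !normrM normrX normr_nat.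
  by apply: ler_wpM2l; rewrite ?mulrn_expr_le.
pose F' x := limn (series (fun r => diffs a r * x ^+ r)).
have aF' : entire_with (diffs a) F' by move=> x; exact: cvg_diffs.
by rewrite (entire_derive1 aF aF').
Qed.

(** The [p]-th derivatives of the partial sums are, up to a shift of the index,
    the partial sums of the [p] times differentiated series. *)
Lemma cvg_derivn_partial_sum (a : nat -> K) (F : K -> K) p l : entire_with a F ->
  ((\poly_(r < n) a r)^`(p)).[l] @[n --> \oo] --> derive1n p F l.
Proof.
elim: p a F => [|p IHp] a F aF.
  rewrite [X in X @ _](_ : _ = series (fun r => a r * l ^+ r)); first exact: aF.
  by apply/funext => n; rewrite derivn0 horner_poly /series /= big_mkord.
rewrite derive1Sn -cvg_shiftS.
rewrite [X in X @ _](_ : _ = fun n => ((\poly_(r < n) diffs a r)^`(p)).[l]).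
  exact/IHp/entire_diffs.
apply/funext => n; rewrite -deriv_poly_diffs -derivSn.
by [].
Qed.

End ComplexSeries.

(** * Taylor polynomials of a quotient *)

Section RationalFunctions.
Context {K : numFieldType}.
Implicit Types (P Q G : {poly K}) (x l : K).

Lemma is_derive_horner_num P x : is_derive x 1 (horner P) (P^`()).[x].
Proof.
elim/poly_ind: P => [|P c IHP].
  rewrite deriv0 horner0 (_ : horner 0 = cst 0); first exact: is_derive_cst.
  by apply/funext => y; rewrite horner0.
have -> : horner (P * 'X + c%:P) = horner P * id + cst c.
  by apply/funext => y; rewrite !hornerE.
apply: is_derive_eq; rewrite derivMXaddC !hornerE /=.
by rewrite /GRing.scale /= mulr1 mulrC.
Qed.

Lemma near_horner_neq0 Q l : Q.[l] != 0 -> \forall x \near l, Q.[x] != 0.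
Proof.
move=> Ql; have : {for l, continuous (horner Q)}.
  have [dQ _] := is_derive_horner_num Q l.
  by apply: differentiable_continuous; apply/derivable1_diffP.
by move=> cQ; exact: (cvgr_neq0 _ cQ Ql).
Qed.

Lemma derive1_quotient P Q x : Q.[x] != 0 ->
  derive1 (fun y => P.[y] / Q.[y]) x =
  (P^`() * Q - P * Q^`()).[x] / (Q ^+ 2).[x].
Proof.
move=> Qx; have [dP eP] := is_derive_horner_num P x.
have [dQ eQ] := is_derive_horner_num Q x.
have := @deriveM _ _ (horner P) (fun y => (horner Q y)^-1) x 1 dP (derivableV Qx dQ).
rewrite derive1E => ->; rewrite deriveV // eP eQ !hornerE /GRing.scale /=.
by field.
Qed.

(** Near [l] the [p]-th derivative of [P / Q] is again a quotient [Pp / Qp] with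
    [Qp.[l] != 0], and the congruence between [P / Q] and [G] can be
    differentiated along with it, losing one power of ['X - l] each time. *)
Lemma derive1n_quotient P Q G l m p : Q.[l] != 0 ->
  ('X - l%:P) ^+ m %| Q * G - P -> (p < m)%N ->
  derive1n p (fun x => P.[x] / Q.[x]) l = (G^`(p)).[l].
Proof.
move=> Ql dvd lt_pm.
have [Pp [Qp [Qpl dvdp nearp]]] : exists Pp Qp, [/\ Qp.[l] != 0,
    ('X - l%:P) ^+ (m - p) %| Qp * G^`(p) - Pp &
    \forall x \near l, derive1n p (fun x => P.[x] / Q.[x]) x = Pp.[x] / Qp.[x]].
  elim: p lt_pm => [|p IHp] lt_pm.
    by exists P, Q; split; [exact: Ql | rewrite subn0 derivn0 | near=> x].
  have [Pp [Qp [Qpl dvdp nearp]]] := IHp (ltnW lt_pm).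
  exists (Pp^`() * Qp - Pp * Qp^`()), (Qp ^+ 2); split.
  - by rewrite horner_exp expf_neq0.
  - have dvdp' : ('X - l%:P) ^+ (m - p.+1) %| Qp * G^`(p) - Pp.
      by apply: dvdp_trans dvdp; apply: dvdp_exp2l; rewrite leq_sub2l.
    have -> : Qp ^+ 2 * G^`(p.+1) - (Pp^`() * Qp - Pp * Qp^`()) =
        Qp * (Qp * G^`(p) - Pp)^`() - Qp^`() * (Qp * G^`(p) - Pp).
      by rewrite derivB derivM -derivnS; ring.
    rewrite dvdp_sub // dvdp_mull //; apply: dvdp_deriv_XsubCX.
    by rewrite subnSK // ltnW.
  - have := near_horner_neq0 Qpl; have := near_join nearp.
    apply: filterS2 => x nearx Qx.
    by rewrite -derive1_quotient // [LHS]derive1E [RHS]derive1E; exact: near_eq_derive.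
have -> := nbhs_singleton nearp.
have : root (Qp * G^`(p) - Pp) l.
  rewrite -dvdp_XsubCl; apply: dvdp_trans dvdp.
  by rewrite -(subnSK lt_pm) exprS dvdp_mulIl.
by rewrite /root !hornerE subr_eq0 => /eqP <-; rewrite mulrAC mulfV // mul1r.
Unshelve. all: by end_near. Qed.

Lemma coprimep_XsubCX_Nroot Q l m : Q.[l] != 0 -> coprimep Q (('X - l%:P) ^+ m).
Proof. by move=> Ql; apply: coprimep_expr; rewrite coprimep_XsubC. Qed.

(** If [u] inverts [Q] modulo [('X - l) ^+ m], then [P / Q] and the polynomial
    [u * P] have the same derivatives at [l] up to order [m], hence the same
    Taylor polynomial. *)
Lemma dvdp_taylor_quotient P Q l m : Q.[l] != 0 ->
  ('X - l%:P) ^+ m %| P - Q * taylor_poly (fun x => P.[x] / Q.[x]) l m.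
Proof.
move=> Ql.
have /Bezout_eq1_coprimepP[[u v] /= uv1] := coprimep_XsubCX_Nroot m Ql.
have dvdG : ('X - l%:P) ^+ m %| Q * (u * P) - P.
  have -> : Q * (u * P) - P = - (v * P) * ('X - l%:P) ^+ m.
    by rewrite -[P in _ - P]mul1r -uv1; ring.
  exact: dvdp_mulIr.
have -> : taylor_poly (fun x => P.[x] / Q.[x]) l m =
    jet (fun p => ((u * P)^`(p)).[l]) l m.
  by apply: eq_bigr => p _; rewrite (derive1n_quotient Ql dvdG).
set t := jet _ _ _.
have -> : P - Q * t = Q * (u * P - t) - (Q * (u * P) - P) by ring.
by rewrite dvdp_sub // dvdp_mull // dvdp_sub_jet.
Qed.

End RationalFunctions.
(** * Functions of an operator through resolvents *)

Section ResolventCalculus.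
Context {K : numFieldType} {V : lmodType K} {k : nat}.
Variables (A : {linear V -> V}) (lam : 'I_k -> K) (m : 'I_k -> nat).
Hypotheses (lam_inj : injective lam) (m_gt0 : forall i, (0 < m i)%N).
Let N : {poly K} := \prod_i ('X - (lam i)%:P) ^+ m i.
Hypothesis NA0 : poly_op N A = 0.
Local Notation L := (principal_resolvent lam m).

Lemma taylor_resolvent_sumE F : taylor_resolvent_sum A lam m F =
  poly_op (\sum_i taylor_poly F (lam i) (m i) * L i) A.
Proof. by rewrite poly_op_sum; apply: eq_bigr => i _; rewrite poly_opM. Qed.

Definition resolvent_term (s : {i : 'I_k & 'I_(m i)}) : V -> V :=
  poly_op (('X - (lam (tag s))%:P) ^+ tagged s * L (tag s)) A.

Lemma poly_op_jet_sum (c : 'I_k -> nat -> K) :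
  poly_op (\sum_i jet (c i) (lam i) (m i) * L i) A =
  \sum_(s : {i : 'I_k & 'I_(m i)})
    (c (tag s) (tagged s) / (tagged s)`!%:R) *: resolvent_term s.
Proof.
rewrite poly_op_sum; under eq_bigr do rewrite /jet mulr_suml poly_op_sum.
rewrite sig_big_dep /=.
by apply: eq_bigr => s _; rewrite -mulrA mul_polyC poly_opZ.
Qed.

(** The polynomial case of the theorem; for entire functions it is applied to
    the partial sums of the series. *)
Lemma poly_op_resolvent_sum g : poly_op g A =
  \sum_(s : {i : 'I_k & 'I_(m i)})
    ((g^`(tagged s)).[lam (tag s)] / (tagged s)`!%:R) *: resolvent_term s.
Proof.
rewrite -(poly_op_jet_sum (fun i p => (g^`(p)).[lam i])).
apply: (poly_op_eqmod NA0); apply: dvdp_sub_resolvent_sum => // i.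
exact: dvdp_sub_jet.
Qed.

Lemma poly_alg_span : poly_alg A = span_set resolvent_term.
Proof.
apply/seteqP; split=> B [g ->].
  by rewrite poly_op_resolvent_sum; eexists.
exists (\sum_(s : {i : 'I_k & 'I_(m i)})
  g s *: (('X - (lam (tag s))%:P) ^+ tagged s * L (tag s))).
by rewrite poly_op_sum; apply: eq_bigr => s _; rewrite poly_opZ.
Qed.

Lemma is_series_op_resolvent (a : nat -> K) (F : K -> K) :
  (forall i p, ((\poly_(r < n) a r)^`(p)).[lam i] @[n --> \oo] -->
     derive1n p F (lam i)) ->
  is_series_op a A (taylor_resolvent_sum A lam m F).
Proof.
move=> cvg_a; rewrite /is_series_op taylor_resolvent_sumE poly_alg_span.
rewrite (poly_op_jet_sum (fun i p => derive1n p F (lam i))).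
rewrite [X in fd_cvg _ X _](_ : _ = fun n => poly_op (\poly_(r < n) a r) A).
  under [X in fd_cvg _ X _]funext do rewrite poly_op_resolvent_sum.
  by apply: fd_cvg_span => s; apply: cvgM; [exact: cvg_a | exact: cvg_cst].
by apply/funext => n; rewrite series_poly_op.
Qed.

(** [Q] is invertible modulo [N], with inverse [u] say, and [u(A)] is the inverse
    of [Q(A)]. *)
Lemma is_quotient_op_resolvent P Q : (forall i, Q.[lam i] != 0) ->
  is_quotient_op P Q A (taylor_resolvent_sum A lam m (fun x => P.[x] / Q.[x])).
Proof.
move=> Qlam; rewrite taylor_resolvent_sumE; set H := \sum_i _.
have /Bezout_eq1_coprimepP[[u v] /= uv1] : coprimep Q N.
  apply: (big_ind (coprimep Q)) => [|p q cp cq|i _].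
  - exact: coprimep1.
  - by rewrite coprimepMr cp.
  - exact: coprimep_XsubCX_Nroot.
have uQ : poly_op (u * Q) A = id.
  rewrite (poly_op_eqmod (q := 1) NA0); last first.
    by rewrite -uv1 opprD addrA subrr sub0r dvdpNr dvdp_mulIr.
  by apply/funext => w; rewrite poly_opC scale1r.
exists (poly_op u A); split.
- by move=> w; rewrite -[LHS]/((poly_op u A \o poly_op Q A) w) -poly_opM uQ.
- by move=> w; rewrite -[LHS]/((poly_op Q A \o poly_op u A) w) -poly_opM mulrC uQ.
rewrite -poly_opM; apply: (poly_op_eqmod NA0).
have dvdH : N %| P - Q * H.
  rewrite mulr_sumr; under eq_bigr do rewrite mulrA.
  by apply: dvdp_sub_resolvent_sum => // i; exact: dvdp_taylor_quotient.
have -> : H - P * u = H * v * N - u * (P - Q * H).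
  by rewrite -[X in X - _]mulr1 -uv1; ring.
by rewrite dvdp_sub ?dvdp_mulIr // dvdp_mull.
Qed.

End ResolventCalculus.

Theorem corollary3p6 (R : realType) (V : lmodType (Cplx R))
    (A : {linear V -> V}) (T : {poly Cplx R})
    (T_neq0 : T != 0) (TA0 : poly_op T A = 0)
    (k : nat) (lam : 'I_k -> Cplx R) (m : 'I_k -> nat)
    (lam_inj : injective lam)
    (lam_roots : forall x : Cplx R, root T x <-> exists i : 'I_k, x = lam i)
    (m_mult : forall i : 'I_k, m i = mup (lam i) T) :
  (forall (F : Cplx R -> Cplx R) (a : nat -> Cplx R),
     entire_with a F ->
     is_series_op a A (taylor_resolvent_sum A lam m F)) /\
  (forall P Q : {poly Cplx R},
     Q != 0 -> coprimep P Q -> (forall i : 'I_k, ~~ root Q (lam i)) ->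
     is_quotient_op P Q A
       (taylor_resolvent_sum A lam m (fun x => P.[x] / Q.[x]))).
Proof.
have m_gt0 i : (0 < m i)%N.
  by rewrite m_mult -XsubC_dvd // dvdp_XsubCl; apply/lam_roots; exists i.
have NA0 : poly_op (\prod_i ('X - (lam i)%:P) ^+ m i) A = 0.
  apply: poly_op_dvdp0 TA0; under eq_bigr do rewrite m_mult.
  by apply: dvdp_closed_prod_XsubCX => // x /lam_roots.
split=> [F a aF | P Q _ _ Qlam].
  apply: is_series_op_resolvent => // i p.
  exact: cvg_derivn_partial_sum.
exact: is_quotient_op_resolvent.
Qed.
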